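(* A ballean $(X,\mathcal{E})$ is normal if and only if $\sim\;=\;\operatorname{cl}\|$, where $\operatorname{cl}\|$ is the closure of the relation $\|$ in $\mathcal{B}^\sharp_{(X,\mathcal{E})}\times\mathcal{B}^\sharp_{(X,\mathcal{E})}$.
   Context: A coarse structure on a set $X$ is a family $\mathcal{E}$ of subsets of $X\times X$ such that: each $E\in\mathcal{E}$ contains the diagonal $\triangle_X=\{(x,x):x\in X\}$; if $E,E'\in\mathcal{E}$ then $E\circ E'\in\mathcal{E}$ and $E^{-1}\in\mathcal{E}$, where $E\circ E'=\{(x,y):\exists z\,((x,z)\in E,\ (z,y)\in E')\}$ and $E^{-1}=\{(y,x):(x,y)\in E\}$; if $E\in\mathcal{E}$ and $\triangle_X\subseteq E'\subseteq E$ then $E'\in\mathcal{E}$; and $\bigcup\mathcal{E}=X\times X$. The pair $(X,\mathcal{E})$ is called a ballean (or coarse space). For $E\in\mathcal{E}$, $x\in X$, $A\subseteq X$: $E[x]=\{y\in X:(x,y)\in E\}$ and $E[A]=\bigcup_{a\in A}E[a]$. A subset $B\subseteq X$ is bounded if $B\subseteq E[x]$ for some $E\in\mathcal{E}$, $x\in X$. Subsets $A,B$ of $X$ are asymptotically disjoint if $E[A]\cap E[B]$ is bounded for every $E\in\mathcal{E}$. A subset $U\subseteq X$ is an asymptotic neighbourhood of $A\subseteq X$ if $E[A]\setminus U$ is bounded for every $E\in\mathcal{E}$. A ballean is normal if any two asymptotically disjoint subsets have disjoint asymptotic neighbourhoods. $X$ is given the discrete topology, and the points of the Stone–Čech compactification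 $\beta X$ are the ultrafilters on $X$. $\mathcal{B}^\sharp_{(X,\mathcal{E})}$ denotes the (closed) subspace of $\beta X$ of all ultrafilters $\varphi$ such that $X\setminus B\in\varphi$ for each bounded $B$. Ultrafilters $p,q\in\mathcal{B}^\sharp_{(X,\mathcal{E})}$ are parallel, written $p\,\|\,q$, if there is $E\in\mathcal{E}$ such that $E[P]\in q$ for each $P\in p$; this is an equivalence relation on $\mathcal{B}^\sharp_{(X,\mathcal{E})}$. $\sim$ denotes the smallest (by inclusion) equivalence relation on $\mathcal{B}^\sharp_{(X,\mathcal{E})}$ that is closed in $\mathcal{B}^\sharp_{(X,\mathcal{E})}\times\mathcal{B}^\sharp_{(X,\mathcal{E})}$ and contains $\|$. *)

(* Defs.v *)
From HB Require Import structures.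
From mathcomp Require Import all_boot.
From mathcomp Require Import all_classical topology.
From Stdlib Require Import RelationClasses.

Set Implicit Arguments.
Unset Strict Implicit.
Unset Printing Implicit Defensive.

Local Open Scope classical_set_scope.
Local Open Scope relation_scope.

(* [E' \; E] is [set xy | exists2 z, E (xy.1, z) & E' (z, xy.2)], i.e. the
   composition usually written E o E' in coarse geometry. *)
Record coarse_structure (X : Type) (EE : set (set (X * X))) : Prop := {
  coarse_diag : forall E, EE E -> diagonal `<=` E;
  coarse_comp : forall E E', EE E -> EE E' -> EE (E' \; E);
  coarse_inv : forall E, EE E -> EE (E^-1);
  coarse_sub : forall E E', EE E -> diagonal `<=` E' -> E' `<=` E -> EE E';
  coarse_cover : \bigcup_(E in EE) E = setT }.

Definition eball (X : Type) (E : set (X * X)) (x : X) : set X :=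
  [set y | E (x, y)].

Definition eballs (X : Type) (E : set (X * X)) (A : set X) : set X :=
  \bigcup_(a in A) eball E a.

Arguments coarse_structure {X} EE.

Section Ballean.
Context {X : Type}.
Variable EE : set (set (X * X)).

Definition coarse_bounded (B : set X) : Prop :=
  exists E x, EE E /\ B `<=` eball E x.

Definition asymp_disjoint (A B : set X) : Prop :=
  forall E, EE E -> coarse_bounded (eballs E A `&` eballs E B).

Definition asymp_nbhd (A U : set X) : Prop :=
  forall E, EE E -> coarse_bounded (eballs E A `\` U).

Definition coarse_normal : Prop :=
  forall A B, asymp_disjoint A B ->
    exists U V, [/\ asymp_nbhd A U, asymp_nbhd B V & U `&` V = set0].

End Ballean.

(* The Stone-Cech compactification of X with the discrete topology: the space of
   ultrafilters p on X, with the sets {p | A \in p}, A a subset of X, as base. *)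
Record stone_cech (X : Type) : Type := StoneCech {
  sc_sets :> set_system X;
  sc_ultra : UltraFilter sc_sets }.

HB.instance Definition _ (X : Type) := gen_eqMixin (stone_cech X).
HB.instance Definition _ (X : Type) := gen_choiceMixin (stone_cech X).

Section StoneCechTopology.
Context {X : Type}.

Definition sc_basic (A : set X) : set (stone_cech X) := [set p | sc_sets p A].

Let sc_cover : \bigcup_(A in setT) sc_basic A = setT.
Proof.
apply/seteqP; split=> // p _; exists setT => //=; rewrite /sc_basic/=.
have := sc_ultra p => ?; exact: filterT.
Qed.

Let sc_join (A B : set X) (p : stone_cech X) : setT A -> setT B ->
    sc_basic A p -> sc_basic B p ->
  exists C, [/\ setT C, sc_basic C p & sc_basic C `<=` sc_basic A `&` sc_basic B].
Proof.
move=> _ _ pA pB; exists (A `&` B); split => //.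
  by have := sc_ultra p => ?; exact: filterI.
move=> q qAB; have := sc_ultra q => ?.
by split; apply: filterS qAB => x [].
Qed.

HB.instance Definition _ :=
  isBaseTopological.Build (stone_cech X) sc_cover sc_join.

End StoneCechTopology.

Section Corona.
Context {X : Type}.
Variable EE : set (set (X * X)).

(* As a type, [corona] carries the subspace topology, and
   [corona * corona] the product topology. *)
Definition corona : set (stone_cech X) :=
  [set p | forall B, coarse_bounded EE B -> sc_sets p (~` B)].

Definition parallel : set (corona * corona) :=
  [set pq | exists2 E, EE E & forall P : set X,
    sc_sets (\val pq.1) P -> sc_sets (\val pq.2) (eballs E P)].

Definition closed_equivalence (R : set (corona * corona)) : Prop :=
  closed R /\ Equivalence (fun p q => R (p, q)).

Definition corona_equiv : set (corona * corona) :=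
  smallest closed_equivalence parallel.

(* The intersection [corona_equiv] of all closed equivalence relations
   containing [parallel] is itself one of them. *)
Lemma corona_equiv_closed_equivalence : closed_equivalence corona_equiv.
Proof.
split; first by apply: closed_bigI => R [[]].
split=> [p R [[_ [+ _ _]] _]|p q pq R RP|p q r pq qr R RP]; first exact.
- by case: (RP) => -[_ [_ + _]] _; apply; exact: pq.
- by case: (RP) => -[_ [_ _ +]] _; apply; [exact: pq|exact: qr].
Qed.

End Corona.

Arguments corona {X} EE.
Arguments parallel {X} EE.
Arguments closed_equivalence {X} EE R.
Arguments corona_equiv {X} EE.

(* Main.v *)
Require Import Defs.
From mathcomp Require Import all_boot.
From mathcomp Require Import all_classical topology.

(** Two facts carry the proof. First, every ideal that contains the bounded sets
    and omits [A] is avoided by some point of the corona containing [A]. Secondly,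
    [(p, q)] lies in the closure of parallelism iff no member of [p] is
    asymptotically disjoint from a member of [q]. The theorem thus says that
    normality is the transitivity of the latter relation.
    If [A] in [p] and [C] in [r] are asymptotically disjoint, with disjoint
    asymptotic neighbourhoods [U] and [V], then [q] contains [~` U], which is
    asymptotically disjoint from [A], or [~` V], which is so from [C]; hence [q]
    cannot be related to both [p] and [r]. Conversely, if [A] and [B] have no
    disjoint asymptotic neighbourhoods, the sets covered by one set
    asymptotically disjoint from [A] and one from [B] form a proper ideal; a
    point [q] avoiding it is related to some point containing [A] and to some
    point containing [B], so by transitivity [A] and [B] are not asymptotically
    disjoint. *)

Set Implicit Arguments.
Unset Strict Implicit.

Local Open Scope classical_set_scope.
Local Open Scope relation_scope.

(** * Balls, bounded sets and asymptotic disjointness *)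

Section Entourages.
Context {X : Type}.
Implicit Types (E : set (X * X)) (A B : set X).

Lemma eballsS E A B : A `<=` B -> eballs E A `<=` eballs E B.
Proof. by move=> AB y [a /AB Ba Eay]; exists a. Qed.

Lemma eballsU E A B : eballs E (A `|` B) = eballs E A `|` eballs E B.
Proof. exact: bigcup_setU. Qed.

End Entourages.

Section Bounded.
Context {X : Type} {EE : set (set (X * X))}.
Hypothesis hEE : coarse_structure EE.
Implicit Types (E F : set (X * X)) (A B : set X).

Lemma entourage_refl E x : EE E -> E (x, x).
Proof. by move=> EEE; apply: (coarse_diag hEE EEE). Qed.

Lemma entourage_containing x y : exists2 E, EE E & E (x, y).
Proof.
have [E EEE Exy] : (\bigcup_(E in EE) E) (x, y) by rewrite (coarse_cover hEE).
by exists E.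
Qed.

Lemma subset_eballs E A : EE E -> A `<=` eballs E A.
Proof. by move=> EEE a Aa; exists a => //; exact: entourage_refl. Qed.

Lemma boundedS A B : A `<=` B -> coarse_bounded EE B -> coarse_bounded EE A.
Proof.
by move=> AB [E [x [EEE BE]]]; exists E, x; split=> //; exact: subset_trans BE.
Qed.

Lemma bounded0 (x : X) : coarse_bounded EE set0.
Proof. by have [E EEE _] := entourage_containing x x; exists E, x; split. Qed.

Lemma boundedU A B :
  coarse_bounded EE A -> coarse_bounded EE B -> coarse_bounded EE (A `|` B).
Proof.
move=> [E [x [EEE AE]]] [F [y [EEF BF]]].
have [G EEG Gxy] := entourage_containing x y.
exists (F \; G \; E), x; split.
  by apply: (coarse_comp hEE) => //; exact: (coarse_comp hEE).
move=> z [/AE Exz|/BF Fyz].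
  by exists z; [exists z => //|]; exact: entourage_refl.
by exists y => //; exists x => //; exact: entourage_refl.
Qed.

Lemma bounded_eballs E A :
  EE E -> coarse_bounded EE A -> coarse_bounded EE (eballs E A).
Proof.
move=> EEE [F [x [EEF AF]]]; exists (E \; F), x; split.
  exact: (coarse_comp hEE).
by move=> z [a /AF Fxa Eaz]; exists a.
Qed.

Lemma asymp_disjoint_sym A B : asymp_disjoint EE A B -> asymp_disjoint EE B A.
Proof. by move=> AB E EEE; rewrite setIC; exact: AB. Qed.

Lemma asymp_disjointS A A' B : A' `<=` A ->
  asymp_disjoint EE A B -> asymp_disjoint EE A' B.
Proof.
move=> A'A AB E EEE; apply: boundedS (AB _ EEE).
by apply: setSI; exact: eballsS.
Qed.

Lemma asymp_disjointU A A' B :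
  asymp_disjoint EE A B -> asymp_disjoint EE A' B ->
  asymp_disjoint EE (A `|` A') B.
Proof.
by move=> AB A'B E EEE; rewrite eballsU setIUl; apply: boundedU; auto.
Qed.

Lemma bounded_asymp_disjoint A B :
  coarse_bounded EE A -> asymp_disjoint EE A B.
Proof.
move=> bA E EEE; apply: boundedS (bounded_eballs EEE bA).
exact: subIsetl.
Qed.

(** If [y] is in the [E]-balls of [A] and of [u] outside [U], then [u] is reached from [A] by [E]
    followed by its inverse, so [y] lies in the [E]-ball of a bounded set. *)
Lemma asymp_nbhdP A U : asymp_nbhd EE A U <-> asymp_disjoint EE A (~` U).
Proof.
split=> AU E EEE; last first.
  apply: boundedS (AU _ EEE) => x [EAx Ux]; split=> //.
  exact: subset_eballs.
have EEV := coarse_inv hEE EEE.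
apply: boundedS (bounded_eballs EEE (AU _ (coarse_comp hEE EEE EEV))).
move=> y [[a Aa Eay] [u Uu Euy]]; exists u => //; split=> //.
by exists a => //; exists y.
Qed.

End Bounded.

(** * Ultrafilters as points *)

Section UltrafilterSets.
Context {X : Type}.
Implicit Types (p : stone_cech X) (A B : set X).

Lemma sc_setsS p A B : A `<=` B -> sc_sets p A -> sc_sets p B.
Proof. by have := sc_ultra p => ?; exact: filterS. Qed.

Lemma sc_setsI p A B : sc_sets p A -> sc_sets p B -> sc_sets p (A `&` B).
Proof. by have := sc_ultra p => ?; exact: filterI. Qed.

Lemma sc_setsT p : sc_sets p setT.
Proof. by have := sc_ultra p => ?; exact: filterT. Qed.

Lemma sc_sets_nonempty p A : sc_sets p A -> A !=set0.
Proof. by have := sc_ultra p => ?; exact: filter_ex. Qed.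

Lemma sc_setsC p A : sc_sets p (~` A) <-> ~ sc_sets p A.
Proof.
have pU := sc_ultra p; split=> [pAC pA|pA].
  by have [x []] := sc_sets_nonempty (sc_setsI pA pAC).
by have [] := in_ultra_setVsetC A pU.
Qed.

Lemma sc_sets_setU p A B : sc_sets p (A `|` B) -> sc_sets p A \/ sc_sets p B.
Proof.
move=> pAB; have [|/sc_setsC pA] := pselect (sc_sets p A); first by left.
by right; apply: sc_setsS (sc_setsI pAB pA) => x [[]].
Qed.

Lemma open_sc_basic A : open (sc_basic A).
Proof.
exists [set A]; first by [].
by rewrite bigcup_set1.
Qed.

Lemma nbhs_sc_basic p W :
  nbhs p W -> exists2 A, sc_sets p A & sc_basic A `<=` W.
Proof.
rewrite nbhsE => -[O [[D _ <-] [A DA pA]] OW]; exists A => //.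
by apply: subset_trans OW => q qA; exists A.
Qed.

End UltrafilterSets.

(** * Points of the corona and parallelism *)

Section Corona.
Context {X : Type} {EE : set (set (X * X))}.
Hypothesis hEE : coarse_structure EE.
Implicit Types (p q r : corona EE) (A B : set X).

Lemma corona_unbounded p A :
  sc_sets (\val p) A -> ~ coarse_bounded EE A.
Proof. by move=> pA /(set_valP p) /sc_setsC. Qed.

(* The sets whose complement in [A] lies in [I] form a proper filter; take any
   ultrafilter above it. *)
Lemma corona_avoiding_ideal (x : X) (I : set (set X)) A :
    coarse_bounded EE `<=` I ->
    (forall P Q, P `<=` Q -> I Q -> I P) ->
    (forall P Q, I P -> I Q -> I (P `|` Q)) ->
    ~ I A ->
  exists2 p : corona EE, sc_sets (\val p) A & forall P, sc_sets (\val p) P -> ~ I P.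
Proof.
move=> bI IS IU nIA.
have FF : ProperFilter [set S | I (A `\` S)].
  apply: Build_ProperFilter_ex.
    move=> S IS'; apply: contrapT => S0; apply: nIA; apply: IS IS' => a Aa.
    by split=> // Sa; apply: S0; exists a.
  split=> [|S T IAS IAT|S T ST IAS] /=.
  - by rewrite setDT; apply: bI; exact: bounded0.
  - by rewrite setDIr; exact: IU.
  - by apply: IS IAS; apply: setDS.
have [G [GU FG]] := ultraFilterLemma FF.
have avoid P : G P -> ~ I P.
  move=> GP IP; have /FG GNP : I (A `\` ~` P) by apply: IS IP => a [_ /contrapT].
  by have [a []] := filter_ex (filterI GP GNP).
have pP : corona EE (StoneCech GU).
  by move=> B /bI IB; apply/sc_setsC => /= /avoid.
exists (SigSub (mem_set pP)) => //=; apply: FG; rewrite /= setDv.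
by apply: bI; exact: bounded0.
Qed.

(** The sets whose [E]-ball is not in [r] form an ideal, to which bounded sets belong because [r] is
    in the corona; [p] avoids it. *)
Lemma parallel_lift r E A : EE E -> sc_sets (\val r) (eballs E A) ->
  exists2 p : corona EE, sc_sets (\val p) A &
    forall P, sc_sets (\val p) P -> sc_sets (\val r) (eballs E P).
Proof.
move=> EEE rEA; have [x _] := sc_sets_nonempty rEA.
have [||||p pA pI] :=
    @corona_avoiding_ideal x [set P | ~ sc_sets (\val r) (eballs E P)] A.
- by move=> B bB /corona_unbounded; apply; exact: bounded_eballs.
- by move=> P Q PQ /= nQ rP; apply: nQ; apply: sc_setsS rP; exact: eballsS.
- by move=> P Q /= nP nQ; rewrite eballsU => /sc_sets_setU [].
- by move=> /=; apply.
by exists p => // P /pI /contrapT.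
Qed.

Lemma parallel_common p q r E : EE E ->
  (forall P, sc_sets (\val p) P -> sc_sets (\val r) (eballs E P)) ->
  (forall Q, sc_sets (\val q) Q -> sc_sets (\val r) (eballs E Q)) ->
  parallel EE (p, q).
Proof.
move=> EEE pr qr; exists (E^-1 \; E).
  by apply: (coarse_comp hEE) => //; exact: (coarse_inv hEE).
move=> P /pr rP /=; apply: contrapT => /sc_setsC /qr rQ.
have [y [[a Pa Eay] [b nb Eby]]] := sc_sets_nonempty (sc_setsI rP rQ).
by apply: nb; exists a => //; exists y.
Qed.

(** Forward, [eballs E A] and [B] both belong to [q], so they meet in an unbounded set. Backward, a
    point [r] containing an unbounded [eballs E A] [&] [eballs E B] lifts to some [p] containing [A]
    and some [q] containing [B], parallel through [r]. *)
Lemma asymp_disjoint_parallel (x : X) A B :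
  asymp_disjoint EE A B <->
  forall p q, parallel EE (p, q) -> sc_sets (\val p) A -> ~ sc_sets (\val q) B.
Proof.
split=> [AB p q [E EEE /= pq] pA qB|AB E EEE].
  apply: (corona_unbounded (sc_setsI (pq _ pA) qB)).
  by apply: boundedS (AB _ EEE); apply: setIS; exact: (subset_eballs hEE EEE).
apply: contrapT => nb.
have [r rAB _] := @corona_avoiding_ideal x (coarse_bounded EE) _ (fun _ => id)
  (@boundedS _ _) (boundedU hEE) nb.
have [p pA pr] := parallel_lift EEE (sc_setsS (@subIsetl _ _ _) rAB).
have [q qB qr] := parallel_lift EEE (sc_setsS (@subIsetr _ _ _) rAB).
exact: (AB p q (parallel_common EEE pr qr)).
Qed.

(** * The closure of parallelism *)

Lemma nbhs_corona_basic p A :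
  sc_sets (\val p) A -> nbhs p [set q : corona EE | sc_sets (\val q) A].
Proof.
move=> pA.
apply: (@initial_continuous (corona EE) _ set_val p (sc_basic A)).
by apply: open_nbhs_nbhs; split; [exact: open_sc_basic|].
Qed.

Lemma nbhs_coronaP p W : nbhs p W ->
  exists2 A, sc_sets (\val p) A & [set q : corona EE | sc_sets (\val q) A] `<=` W.
Proof.
rewrite nbhsE => -[_ [[O oO <-] Op] OW].
have [A pA AO] := nbhs_sc_basic (open_nbhs_nbhs (conj oO Op)).
by exists A => // q qA; apply: OW; exact: AO.
Qed.

(** A box given by [A] in [p] and [B] in [q] contains a parallel pair exactly when [A] and [B] are
    not asymptotically disjoint. *)
Lemma closure_parallelP p q :
  closure (parallel EE) (p, q) <->
  forall A B, sc_sets (\val p) A -> sc_sets (\val q) B ->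
    ~ asymp_disjoint EE A B.
Proof.
have [x _] := sc_sets_nonempty (sc_setsT (\val p)).
split=> [pq A B pA qB /(asymp_disjoint_parallel x) AB|pq W [[U V] [/= pU qV] UVW]].
  have [|[p' q'] [/= par [p'A q'B]]] := pq
      ([set p' : corona EE | sc_sets (\val p') A] `*`
       [set q' : corona EE | sc_sets (\val q') B]).
    by exists ([set p' : corona EE | sc_sets (\val p') A],
      [set q' : corona EE | sc_sets (\val q') B]) => //; split;
      exact: nbhs_corona_basic.
  exact: AB par p'A q'B.
have [A pA AU] := nbhs_coronaP pU.
have [B qB BV] := nbhs_coronaP qV.
have := pq A B pA qB => /(asymp_disjoint_parallel x) /existsNP [p'].
move=> /existsNP [q'] /not_implyP [par] /not_implyP [p'A] /contrapT q'B.
by exists (p', q'); split=> //; apply: UVW; split; [exact: AU|exact: BV].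
Qed.

Lemma closure_parallel_refl p : closure (parallel EE) (p, p).
Proof.
apply/closure_parallelP => A B pA pB AB.
have [x _] := sc_sets_nonempty pA; have [E EEE _] := entourage_containing hEE x x.
apply: (corona_unbounded (sc_setsI pA pB)).
by apply: boundedS (AB _ EEE); apply: setISS; exact: (subset_eballs hEE EEE).
Qed.

Lemma closure_parallel_sym p q :
  closure (parallel EE) (p, q) -> closure (parallel EE) (q, p).
Proof.
move=> /closure_parallelP pq; apply/closure_parallelP => A B qA pB.
by move=> /asymp_disjoint_sym; exact: pq.
Qed.

(** The closure is reflexive, symmetric and contained in every closed equivalence above [parallel],
    so only transitivity is at stake. *)
Lemma corona_equiv_closureP :
  corona_equiv EE = closure (parallel EE) <->
  forall p q r, closure (parallel EE) (p, q) -> closure (parallel EE) (q, r) ->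
    closure (parallel EE) (p, r).
Proof.
have [cl [_ _ tr]] := corona_equiv_closed_equivalence EE.
split=> [<- //|trans]; apply/seteqP; split=> [pq|].
  apply; split; last exact: subset_closure.
  split; first exact: closed_closure.
  by split; [exact: closure_parallel_refl|exact: closure_parallel_sym|].
by rewrite closureE; apply: smallest_sub => //; exact: sub_smallest.
Qed.

(** * Normality as transitivity *)

Lemma normal_closure_parallel_trans p q r : coarse_normal EE ->
  closure (parallel EE) (p, q) -> closure (parallel EE) (q, r) ->
  closure (parallel EE) (p, r).
Proof.
move=> nEE /closure_parallelP pq /closure_parallelP qr.
apply/closure_parallelP => A C pA rC /nEE [U [V [AU CV UV]]].
have : sc_sets (\val q) (~` U `|` ~` V).
  by rewrite -setCI UV setC0; exact: sc_setsT.
move=> /sc_sets_setU [qU|qV].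
  by apply: pq pA qU _; exact/asymp_nbhdP.
by apply: qr qV rC _; apply: asymp_disjoint_sym; exact/asymp_nbhdP.
Qed.

(** The sets asymptotically disjoint from some member of [q] form an ideal omitting [A]; [p] avoids
    it. *)
Lemma corona_not_asymp_disjoint q A :
  (forall Q, sc_sets (\val q) Q -> ~ asymp_disjoint EE A Q) ->
  exists2 p : corona EE, sc_sets (\val p) A & closure (parallel EE) (p, q).
Proof.
move=> Aq; have [x _] := sc_sets_nonempty (sc_setsT (\val q)).
have [||||p pA pI] := @corona_avoiding_ideal x
    [set P | exists2 Q, sc_sets (\val q) Q & asymp_disjoint EE P Q] A.
- move=> B bB; exists setT; first exact: sc_setsT.
  exact: bounded_asymp_disjoint.
- by move=> P P' PP' [Q qQ P'Q]; exists Q => //; exact: asymp_disjointS P'Q.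
- move=> P P' [Q qQ PQ] [Q' qQ' P'Q']; exists (Q `&` Q'); first exact: sc_setsI.
  apply: asymp_disjointU => //; apply: asymp_disjoint_sym.
    by apply: asymp_disjointS (asymp_disjoint_sym PQ); exact: subIsetl.
  by apply: asymp_disjointS (asymp_disjoint_sym P'Q'); exact: subIsetr.
- by move=> [Q /Aq].
by exists p => //; apply/closure_parallelP => P Q /pI nP qQ PQ; apply: nP; exists Q.
Qed.

Lemma closure_parallel_trans_normal (x : X) :
  (forall p q r, closure (parallel EE) (p, q) ->
    closure (parallel EE) (q, r) -> closure (parallel EE) (p, r)) ->
  coarse_normal EE.
Proof.
move=> trans A B AB; apply: contrapT => nUV.
pose I := [set S | exists S1 S2,
  [/\ S `<=` S1 `|` S2, asymp_disjoint EE A S1 & asymp_disjoint EE B S2]].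
have dis0 C : asymp_disjoint EE C set0.
  by apply: asymp_disjoint_sym; apply: bounded_asymp_disjoint => //; exact: bounded0.
have [||||q _ qI] := @corona_avoiding_ideal x I setT.
- move=> C bC; exists C, set0; split=> //.
  by apply: asymp_disjoint_sym; exact: bounded_asymp_disjoint.
- move=> P Q PQ [S1 [S2 [QS AS BS]]]; exists S1, S2; split=> //.
  exact: subset_trans QS.
- move=> P P' [S1 [S2 [PS AS BS]]] [T1 [T2 [PT AT BT]]].
  exists (S1 `|` T1), (S2 `|` T2); split.
  + by rewrite setUACA; exact: setUSS.
  + by apply: asymp_disjoint_sym; apply: asymp_disjointU => //;
      exact: asymp_disjoint_sym.
  + by apply: asymp_disjoint_sym; apply: asymp_disjointU => //;
      exact: asymp_disjoint_sym.
(* The ideal is proper: if [S1] and [S2] cover [X], their complements are disjoint asymptotic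
   neighbourhoods. *)
- move=> [S1 [S2 [TS AS BS]]]; apply: nUV; exists (~` S1), (~` S2); split.
  + by apply/asymp_nbhdP => //; rewrite setCK.
  + by apply/asymp_nbhdP => //; rewrite setCK.
  + by rewrite -setCU -subset0 => y; apply; exact: TS.
have [Q qQ AQ|p pA pq] := @corona_not_asymp_disjoint q A.
  by apply: (qI Q qQ); exists Q, set0; split=> //; exact: subsetUl.
have [Q qQ BQ|r rB rq] := @corona_not_asymp_disjoint q B.
  by apply: (qI Q qQ); exists set0, Q; split=> //; exact: subsetUr.
have /closure_parallelP pr := trans _ _ _ pq (closure_parallel_sym rq).
exact: pr pA rB AB.
Qed.

End Corona.

Theorem theorem17 (X : Type) (EE : set (set (X * X)))
    (hEE : coarse_structure EE) :
  coarse_normal EE <-> corona_equiv EE = closure (parallel EE).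
Proof.
rewrite corona_equiv_closureP //; split=> [nEE p q r|trans].
  exact: normal_closure_parallel_trans.
have [[x]|nX] := pselect (inhabited X); first exact: closure_parallel_trans_normal.
(* If [X] is empty then not even [set0] is bounded, as boundedness asks for a
   centre, but then [setT = set0] is vacuously an asymptotic neighbourhood
   unless there is an entourage, in which case no two sets are asymptotically
   disjoint. *)
move=> A B AB; exists set0, set0; rewrite setI0.
by split=> // E EEE; have [_ [x _]] := AB E EEE; exfalso; apply: nX.
Qed.
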